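(* Let $K\subset\mathbb R^2$ be a compact convex set of area 1, and assume that for some $\lambda\ge0$, under $\mathsf Q^K_{n,\lfloor n\lambda\rfloor}$, $\mathsf{CH}(\{U_1,\dots,U_{n+\lfloor n\lambda\rfloor}\})$ converges in probability to $K$ for the Hausdorff topology as $n\to+\infty$. Then for any $\lambda'\ge\lambda$, under $\mathsf Q^K_{n,\lfloor n\lambda'\rfloor}$, $\mathsf{CH}(\{U_1,\dots,U_{n+\lfloor n\lambda'\rfloor}\})$ converges in probability to $K$ for the Hausdorff topology as $n\to+\infty$.
   Context: $\mathsf{CH}$ denotes the convex hull. For a compact convex set $K$ of area 1 and integers $n,m\ge0$, let $U_1,\dots,U_{n+m}$ be i.i.d. uniform points in $K$. $\mathsf Q^K_{n,m}$ denotes the law of $(U_1,\dots,U_{n+m})$ conditional on the event that $\mathsf{CH}(\{U_1,\dots,U_{n+m}\})$ has exactly $n$ vertices. *)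

(* Defs.v *)
From HB Require Import structures.
From mathcomp Require Import all_boot all_order all_algebra.
From mathcomp Require Import all_classical all_reals all_analysis.
From mathcomp Require Import measurable_realfun.

Set Implicit Arguments.
Unset Strict Implicit.
Unset Printing Implicit Defensive.
Import Order.TTheory GRing.Theory Num.Theory numFieldNormedType.Exports.
Local Open Scope classical_set_scope.
Local Open Scope ring_scope.

(* [measurableTypeR R] is the type R with the Borel sigma-algebra on which
   [lebesgue_measure] is defined; [plane R] is thus R * R, and it inherits the
   usual vector space, (sup-)norm and topology of R * R. *)
Definition plane (R : realType) := (measurableTypeR R * measurableTypeR R)%type.

Definition area {R : realType} : {measure set (plane R) -> \bar R} :=
  (@lebesgue_measure R \x @lebesgue_measure R)%E.

Definition conv_hull (R : numDomainType) (M : lmodType R) (A : set M) : set M :=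
  \bigcap_(C in [set C : set M | convex_set C /\ A `<=` C]) C.

(* The vertices of a polygon are its extreme points. *)
Definition vertices (R : numDomainType) (M : lmodType R) (C : set M) : set M :=
  [set x | C x /\ forall (y z : M) (t : R), C y -> C z -> 0 < t < 1 ->
    x = t *: y + (1 - t) *: z -> y = x /\ z = x].

(* On nonempty compact sets this distance is finite and metrizes the Hausdorff
   topology, which only depends on the topology of the ambient space; on
   [plane R] it is computed with the sup norm. *)
Definition hausdorff_dist (R : realType) (T : pseudoMetricType R)
    (A B : set T) : \bar R :=
  Order.max (ereal_sup [set edist_inf B x | x in A])
            (ereal_sup [set edist_inf A x | x in B]).

Section compact_measurable_plane.
Variable R : realType.

Lemma open_measurable_plane (A : set (plane R)) : open A -> measurable A.
Proof.
move=> oA.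
pose box (q : rat * rat * rat) : set (plane R) :=
  ball (ratr q.1.1 : R) (ratr q.2) `*` ball (ratr q.1.2 : R) (ratr q.2).
have -> : A = \bigcup_(q in [set: rat * rat * rat])
    (if `[< box q `<=` A >] then box q else set0).
  apply/seteqP; split => [[x y] Axy|z [q _]]; last first.
    by case: asboolP => // qA /qA.
  have /nbhs_ballP[e /= e0 eA] : nbhs ((x, y) : plane R) A by exact: open_nbhs_nbhs.
  have e40 : 0 < e / 4%:R by rewrite divr_gt0.
  have [r] : exists r : rat, ratr r \in `](e / 4%:R), (e / 2%:R)[.
    by apply: rat_in_itvoo; rewrite ltr_pM2l// ltf_pV2 ?posrE// ltr_nat.
  rewrite in_itv/= => /andP[r1 r2].
  have approx (w : R) : exists p : rat, `|ratr p - w| < e / 4%:R.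
    have [p] : exists p : rat, ratr p \in `]w - e / 4%:R, (w + e / 4%:R)[.
      by apply: rat_in_itvoo; rewrite ltrD2l gt0_cp.
    by rewrite in_itv/= => pw; exists p; rewrite ltr_distl.
  have [a ax] := approx x; have [b bY] := approx y.
  exists (a, b, r) => //.
  have in_box : box (a, b, r) (x, y).
    by split; rewrite /box /= -ball_normE /=; exact: lt_trans r1.
  case: asboolP => // -[] [x' y'] [] /=.
  rewrite -!ball_normE /= => ax' bY'; apply: eA.
  have tri (p w w' : R) : `|p - w| < e / 4%:R -> `|p - w'| < ratr r ->
      `|w - w'| < e.
    move=> h1 h2; rewrite [ltRHS]splitr (le_lt_trans (ler_distD p w w'))//.
    rewrite ltrD// ?(lt_trans h2)// distrC (lt_trans h1)//.
    exact: lt_trans r1 r2.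
  by split; rewrite /= -ball_normE /=; [exact: tri ax ax'|exact: tri bY bY'].
apply: countable_bigcupT_measurable => // q.
by case: ifPn => // _; apply: measurableX; apply: open_measurable; apply: ball_open.
Qed.

Lemma compact_measurable_plane (A : set (plane R)) : compact A -> measurable A.
Proof.
move=> cA; rewrite -(setCK A); apply: measurableC; apply: open_measurable_plane.
rewrite openC; apply: compact_closed => //; exact: norm_hausdorff.
Qed.

End compact_measurable_plane.

Section uniform_law.
Variables (R : realType) (K : set (plane R)) (cK : compact K).

Definition uniform_law (_ : area K = 1%E) : set (plane R) -> \bar R :=
  mrestr area (compact_measurable_plane cK).

Variable aK : area K = 1%E.

HB.instance Definition _ := Measure.on (uniform_law aK).

Let uniform_lawT : uniform_law aK [set: plane R] = 1%E.
Proof. by rewrite /uniform_law /mrestr setTI. Qed.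

HB.instance Definition _ :=
  Measure_isProbability.Build _ _ _ (uniform_law aK) uniform_lawT.

End uniform_law.

Section iid_law.
Context d (T : measurableType d) (R : realType) (P : probability T R).

Definition tuple_cons n (x : T * n.-tuple T) : n.+1.-tuple T :=
  [the n.+1.-tuple T of x.1 :: x.2].

Let measurable_tuple_cons n : measurable_fun setT (@tuple_cons n).
Proof. exact: measurable_cons measurable_fst measurable_snd. Qed.

HB.instance Definition _ n :=
  isMeasurableFun.Build _ _ _ _ (@tuple_cons n) (@measurable_tuple_cons n).

(* The n-fold product of P, that is, the law of n i.i.d. points of law P. *)
Fixpoint iid_law n : probability (n.-tuple T) R :=
  match n with
  | 0 => \d_([tuple] : 0.-tuple T)
  | n'.+1 => distribution (P \x iid_law n')%E (@tuple_cons n')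
  end.

End iid_law.

Section conditional_law.
Variables (R : realType) (K : set (plane R)).
Variables (cK : compact K) (aK : area K = 1%E).

Definition hull N (u : N.-tuple (plane R)) : set (plane R) :=
  conv_hull (range (tnth u)).

Definition n_vertices n N : set (N.-tuple (plane R)) :=
  [set u | (vertices (hull u) #= `I_n)%card].

(* Q^K_{n,m}. The conditioning event has positive probability as soon as
   n >= 3; when it is null, division by zero makes this function vanish. *)
Definition Q n m (A : set ((n + m).-tuple (plane R))) : R :=
  let P := iid_law (uniform_law cK aK) (n + m) in
  fine (P (A `&` @n_vertices n (n + m))) / fine (P (@n_vertices n (n + m))).

Definition hull_cvg_in_probability (m : nat -> nat) :=
  forall eps : R, 0 < eps ->
    @Q n (m n) [set u | (eps%:E < hausdorff_dist (hull u) K)%E] @[n --> \oo]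
      --> (0 : R).

End conditional_law.

(* Main.v *)
Require Import Defs.
From mathcomp Require Import all_boot all_order all_algebra.
From mathcomp Require Import all_classical all_reals all_analysis.
From mathcomp Require Import measurable_realfun perm ring lra.
Import Order.TTheory GRing.Theory Num.Theory numFieldNormedType.Exports.
Local Open Scope classical_set_scope.
Local Open Scope ring_scope.

Set Implicit Arguments.
Unset Strict Implicit.
Unset Printing Implicit Defensive.

(** The law of the hull under Q_(n,m) has, with respect to the law of n points
    conditioned to be in convex position, a density proportional to the m-th
    power of the area, so a larger m favours hulls of larger area. Since the
    hull lies in K, which has area 1, it is close to K exactly when its area is
    close to 1; hence convergence to K is inherited by larger values of m.

    Monotonicity in m is proved one point at a time. Let Phi be a property of
    the hull that implies that it has n vertices. Among N + 1 points, almost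
    surely distinct, with n vertices, exactly N + 1 - n are redundant: each
    lies in the hull of the others. By exchangeability, the redundant point may
    be assumed to be the first one, which is uniform and independent of the
    rest. This gives [iid_law_hull_event_step]:

      (N + 1 - n) P(Phi(hull of N + 1 points))
        = (N + 1) E[area(hull of N points) ; Phi(hull of N points)].

    Applied to the hulls of area at most c, and then to those of area larger
    than c, the identity shows that adding a point multiplies the probability
    of the former by at most (N + 1) c / (N + 1 - n) and that of the latter by
    at least this factor. Hence the conditional probability of a hull of area
    at most c given n vertices does not increase with the number of points
    ([small_hull_nonincreasing]).

    Two geometric facts relate area and Hausdorff distance uniformly over the
    polygons in K: a polygon far from K misses a copy of K shrunk by a fixed
    ratio ([far_hull_deficit]), and a polygon close to K contains a copy of K
    shrunk towards an interior point by a ratio close to 1 ([near_hull_area]).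

    The number of vertices and the area of the hull are measurable because a
    point is outside the hull of finitely many points exactly when one of
    countably many linear forms, those with rational coefficients, separates it
    from them ([separation]). *)

(** * Convex hulls *)

Section convex_hull.
Variables (R : realType) (M : lmodType R).
Implicit Types (A B C : set M) (x y : M).

Lemma convex_setP C : convex_set C <->
  forall x y (t : R), C x -> C y -> 0 <= t <= 1 -> C (t *: x + (1 - t) *: y).
Proof.
split=> [cC x y t Cx Cy t01|cC x y t /set_mem Cx /set_mem Cy].
  have := cC x y (Itv01 (andP t01).1 (andP t01).2).
  by rewrite !inE; exact.
apply/mem_set; have := cC x y t%:num Cx Cy; apply.
by rewrite ge0 le1.
Qed.

Lemma convex_conv_hull A : convex_set (conv_hull A).
Proof.
apply/convex_setP => x y t Ax Ay t01 C CA.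
have /convex_setP cC := CA.1.
by apply: cC t01; [exact: Ax|exact: Ay].
Qed.

Lemma sub_conv_hull A : A `<=` conv_hull A.
Proof. by move=> x Ax C [_]; exact. Qed.

Lemma conv_hull_min A C : convex_set C -> A `<=` C -> conv_hull A `<=` C.
Proof. by move=> cC AC x; apply. Qed.

Lemma conv_hullS A B : A `<=` B -> conv_hull A `<=` conv_hull B.
Proof.
move=> AB; apply: conv_hull_min; first exact: convex_conv_hull.
exact: subset_trans AB (@sub_conv_hull B).
Qed.

Lemma conv_hull_absorb A x : conv_hull A x -> conv_hull (x |` A) = conv_hull A.
Proof.
move=> Ax; apply/seteqP; split; last by apply: conv_hullS => y; right.
apply: conv_hull_min; first exact: convex_conv_hull.
by move=> y [->//|Ay]; exact: (@sub_conv_hull A).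
Qed.

(** Removing an extreme point from a convex set leaves a convex set, so a
    generating set cannot do without the extreme points of its hull. *)
Lemma vertex_necessary A x : vertices (conv_hull A) x ->
  A x /\ ~ conv_hull (A `\ x) x.
Proof.
move=> [hx ext].
have cD : convex_set (conv_hull A `\ x).
  apply/convex_setP => y z t [hy yx] [hz zx] t01; split.
    by move/convex_setP: (@convex_conv_hull A); apply.
  move=> e; have [t0|t0] := eqVneq t 0.
    by apply: zx; rewrite -e t0 scale0r add0r subr0 scale1r.
  have [t1|t1] := eqVneq t 1.
    by apply: yx; rewrite -e t1 scale1r subrr scale0r addr0.
  have t01' : 0 < t < 1.
    by move: t01 => /andP[? ?]; rewrite !lt_neqAle eq_sym t0 t1; apply/andP.
  by have [/yx] := ext y z t hy hz t01' (esym e).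
split.
  apply: contrapT => nAx.
  have sub : A `<=` conv_hull A `\ x.
    move=> y Ay; split; first exact: (@sub_conv_hull A).
    by move=> yx; apply: nAx; rewrite -yx.
  by have [_] := conv_hull_min cD sub hx; apply.
have sub : A `\ x `<=` conv_hull A `\ x.
  by move=> y [/sub_conv_hull].
by move/(conv_hull_min cD sub) => [_]; apply.
Qed.

End convex_hull.

(** * Separation by a linear form in the plane *)

Section separation.
Variable R : realType.
Implicit Types (l v w x y z : plane R) (s : seq (plane R)).

(** Rewriting rules instead of simplification: the scaling of a coordinate then
    appears as a product of real numbers. *)
Definition planeE := (
  (fun x y => erefl : (x + y).1 = x.1 + y.1 :> R),
  (fun x y => erefl : (x + y).2 = x.2 + y.2 :> R),
  (fun x => erefl : (- x).1 = - x.1 :> R),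
  (fun x => erefl : (- x).2 = - x.2 :> R),
  (fun (t : R) x => erefl : (t *: x).1 = t * x.1 :> R),
  (fun (t : R) x => erefl : (t *: x).2 = t * x.2 :> R)).

Lemma plane_eq x y : x.1 = y.1 :> R -> x.2 = y.2 :> R -> x = y.
Proof. by case: x y => [x1 x2] [y1 y2] /= -> ->. Qed.

Definition lin l x : R := (l.1 : R) * x.1 + (l.2 : R) * x.2.

Lemma lin_conv l x y (t : R) :
  lin l (t *: x + (1 - t) *: y) = t * lin l x + (1 - t) * lin l y.
Proof. by rewrite /lin ?planeE /=; ring. Qed.

Lemma linB l x y : lin l (x - y) = lin l x - lin l y.
Proof. by rewrite /lin ?planeE /=; ring. Qed.

Lemma convex_lin_lt l (c : R) : convex_set [set x | lin l x < c].
Proof.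
apply/convex_setP => x y t /= xc yc /andP[t0 t1]; rewrite lin_conv.
have [->|tn0] := eqVneq t 0; first by lra.
have : 0 < t * (c - lin l x) by rewrite mulr_gt0 ?subr_gt0// lt_neqAle eq_sym tn0.
nra.
Qed.

(** This serves twice: to perturb a form, and to replace it by a rational one. *)
Lemma lin_gt0_near l s : (forall v, v \in s -> 0 < lin l v) ->
  exists2 e : R, 0 < e & forall l', `|l'.1 - l.1| < e -> `|l'.2 - l.2| < e ->
    forall v, v \in s -> 0 < lin l' v.
Proof.
elim: s => [|w s IH] ls; first by exists 1.
have [|e e0 He] := IH; first by move=> v vs; apply: ls; rewrite inE vs orbT.
have lw : 0 < lin l w by apply: ls; rewrite mem_head.
(* the added 1 only avoids a division by zero when w = 0 *)
pose d := lin l w / (`|w.1| + `|w.2| + 1).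
have q0 : 0 < `|w.1| + `|w.2| + 1 :> R by rewrite ltr_wpDl// addr_ge0.
have d0 : 0 < d by rewrite divr_gt0.
exists (Num.min e d); first by rewrite lt_min e0.
move=> l'; rewrite !lt_min => /andP[a1 a2] /andP[b1 b2] v.
rewrite inE => /predU1P[->|]; last exact: He.
have E : lin l' w = lin l w + ((l'.1 - l.1) * w.1 + (l'.2 - l.2) * w.2).
  by rewrite /lin; ring.
have : `|(l'.1 - l.1) * w.1 + (l'.2 - l.2) * w.2| < lin l w.
  rewrite (le_lt_trans (ler_normD _ _))// !normrM.
  rewrite (@le_lt_trans _ _ (d * (`|w.1| + `|w.2|)))//.
    by rewrite mulrDr lerD// ler_wpM2r// ltW.
  by rewrite /d mulrAC ltr_pdivrMr// ltr_pM2l// ltrDl.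
rewrite E ltr_norml => /andP[+ _]; lra.
Qed.

(** A form that vanishes at w and is positive on s is made positive at w by
    adding a small multiple of the form of gradient w. *)
Lemma lin_gt0_perturb l w s : lin l w = 0 -> 0 < lin w w ->
  (forall v, v \in s -> 0 < lin l v) ->
  exists l', forall v, v \in w :: s -> 0 < lin l' v.
Proof.
move=> lw ww /lin_gt0_near[e e0 He].
pose d := e / (`|w.1| + `|w.2| + 1).
have q0 : 0 < `|w.1| + `|w.2| + 1 :> R by rewrite ltr_wpDl// addr_ge0.
have d0 : 0 < d by rewrite divr_gt0.
have bound (a : R) : `|a| <= `|w.1| + `|w.2| -> `|d * a| < e.
  move=> ab; rewrite normrM (gtr0_norm d0) /d mulrAC ltr_pdivrMr//.
  by rewrite ltr_pM2l// (le_lt_trans ab)// ltrDl.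
exists (l + d *: w) => v; rewrite inE => /predU1P[->|].
  have -> : lin (l + d *: w) w = lin l w + d * lin w w by rewrite /lin ?planeE /=; ring.
  by rewrite lw add0r mulr_gt0.
by apply: He; rewrite planeE addrC addKr planeE; apply: bound; rewrite ?lerDl ?lerDr.
Qed.

Definition cross v w : R := (v.1 : R) * w.2 - (v.2 : R) * w.1.

Definition quarter_turn v : plane R := (- v.2, v.1).

Lemma lin_quarter_turn v w : lin (quarter_turn v) w = cross v w.
Proof. by rewrite /lin /cross ?planeE /=; ring. Qed.

Lemma lin_self_gt0 w : w != 0 -> 0 < lin w w.
Proof.
move=> w0; rewrite /lin lt_neqAle addr_ge0 -?expr2 ?sqr_ge0// andbT.
rewrite eq_sym; apply: contra w0; rewrite !expr2 => /eqP e.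
have w1 : w.1 = 0 by nra.
have w2 : w.2 = 0 by nra.
by rewrite (surjective_pairing w) w1 w2.
Qed.

(** As v and w are collinear and l does not have the same sign on them, the
    origin is between them, with weights given by l. *)
Lemma conv_hull_opposite (C : set (plane R)) l v w : convex_set C ->
  C v -> C w -> cross w v = 0 -> 0 < lin l v -> lin l w <= 0 -> w != 0 -> C 0.
Proof.
move=> /convex_setP cC Cv Cw wv lv lw w0.
have q : 0 < lin l v - lin l w by lra.
pose t := - lin l w / (lin l v - lin l w).
have -> : 0 = t *: v + (1 - t) *: w :> plane R.
  have t1 : 1 - t = lin l v / (lin l v - lin l w) by rewrite /t; field; lra.
  have coor (a b : R) : b * lin l v = a * lin l w -> 0 = t * a + (1 - t) * b.
    move=> e; rewrite t1 /t.
    have -> : - lin l w / (lin l v - lin l w) * a +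
        lin l v / (lin l v - lin l w) * b =
        (b * lin l v - a * lin l w) / (lin l v - lin l w) by field; lra.
    by rewrite e subrr mul0r.
  congr pair => /=; apply: coor; rewrite /lin.
  - have : l.2 * cross w v = 0 by rewrite wv mulr0.
    by rewrite /cross; nra.
  - have : l.1 * cross w v = 0 by rewrite wv mulr0.
    by rewrite /cross; nra.
apply: cC => //; apply/andP; split; first by rewrite /t divr_ge0 ?(ltW q)//; lra.
by rewrite /t ler_pdivrMr//; lra.
Qed.

(** Gordan's alternative. Suppose that a form is positive on s but not at w. If
    s lies strictly on one side of the line spanned by w, the equation of this
    line can be perturbed into a form positive on s and at w. Otherwise some
    segment between vectors of s meets this line; as the form is positive on the
    segment, it does so on the ray opposite to w, so the origin is in the hull. *)
Lemma gordan s :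
  (exists l, forall v, v \in s -> 0 < lin l v) \/ conv_hull [set` s] 0.
Proof.
elim: s => [|w s [[l ls]|s0]]; first by left; exists 0.
  have [lw|lw] := ltP 0 (lin l w).
    by left; exists l => v; rewrite inE => /predU1P[->|/ls].
  have hw : conv_hull [set` w :: s] w by apply: sub_conv_hull; rewrite /= mem_head.
  have hs v : v \in s -> conv_hull [set` w :: s] v.
    by move=> vs; apply: sub_conv_hull; rewrite /= inE vs orbT.
  have [w0|w0] := eqVneq w 0; first by right; rewrite -[X in conv_hull _ X]w0.
  have ww := lin_self_gt0 w0.
  have cvx := @convex_conv_hull _ _ [set` w :: s].
  have [pos|/existsNP[v1 /not_implyP[v1s /negP v1n]]] :=
      pselect (forall v, v \in s -> 0 < cross w v).
    left; apply: (@lin_gt0_perturb (quarter_turn w)) => //.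
      by rewrite lin_quarter_turn /cross; ring.
    by move=> v vs; rewrite lin_quarter_turn pos.
  have [neg|/existsNP[v2 /not_implyP[v2s /negP v2n]]] :=
      pselect (forall v, v \in s -> cross w v < 0).
    left; apply: (@lin_gt0_perturb (quarter_turn (- w))) => //.
      by rewrite lin_quarter_turn /cross ?planeE /=; ring.
    move=> v vs; rewrite lin_quarter_turn.
    have -> : cross (- w) v = - cross w v by rewrite /cross ?planeE /=; ring.
    by rewrite oppr_gt0 neg.
  right; rewrite -!leNgt in v1n v2n.
  have [c1|c1] := eqVneq (cross w v1) 0.
    exact: (conv_hull_opposite cvx (hs _ v1s) hw c1 (ls _ v1s)).
  have q : 0 < cross w v2 - cross w v1.
    by have := lt_neqAle (cross w v1) 0; rewrite c1 v1n /=; lra.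
  pose t := cross w v2 / (cross w v2 - cross w v1).
  have t01 : 0 <= t <= 1.
    apply/andP; split; first by rewrite /t divr_ge0 ?(ltW q).
    by rewrite /t ler_pdivrMr//; lra.
  apply: (@conv_hull_opposite _ l (t *: v1 + (1 - t) *: v2) w cvx) => //.
  - by move/convex_setP: cvx; apply=> //; exact: hs.
  - have -> : cross w (t *: v1 + (1 - t) *: v2) =
      t * cross w v1 + (1 - t) * cross w v2 by rewrite /cross ?planeE /=; ring.
    by rewrite /t; field; lra.
  - rewrite lin_conv; have := ls _ v1s; have := ls _ v2s; nra.
by right; apply: conv_hullS s0 => v /= vs; rewrite inE vs orbT.
Qed.

Definition rat_form (q : rat * rat) : plane R := (ratr q.1, ratr q.2).

(** The form obtained from Gordan's alternative for the vectors from the points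
    of s to x may be moved slightly, hence chosen rational. *)
Lemma separation s x : ~ conv_hull [set` s] x ->
  exists q, forall y, y \in s -> lin (rat_form q) y < lin (rat_form q) x.
Proof.
move=> nx; have [[l ls]|h0] := gordan [seq x - y | y <- s]; last first.
  exfalso; apply: nx.
  have : [set z | conv_hull [set` s] (x - z)] 0.
    apply: (conv_hull_min _ _ h0).
      apply/convex_setP => a b t /= ha hb t01.
      have -> : x - (t *: a + (1 - t) *: b) =
          t *: (x - a) + (1 - t) *: (x - b).
        by apply: plane_eq; rewrite !planeE; ring.
      by move/convex_setP: (@convex_conv_hull _ _ [set` s]); apply.
    by move=> _ /mapP[y ys ->] /=; rewrite subKr; exact: sub_conv_hull.
  by rewrite /= subr0.
have [e e0 He] := lin_gt0_near ls.
have approx (a : R) : exists p : rat, `|ratr p - a| < e.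
  have [p] : exists p : rat, ratr p \in `]a - e, (a + e)[.
    by apply: rat_in_itvoo; lra.
  by rewrite in_itv/= => pw; exists p; rewrite ltr_distl.
have [[a la] [b lb]] := (approx l.1, approx l.2).
exists (a, b) => y ys; rewrite -subr_gt0 -linB.
by apply: He => //; apply: map_f.
Qed.

Lemma conv_hull_sepP s x : conv_hull [set` s] x <->
  forall q, exists2 y, y \in s & lin (rat_form q) x <= lin (rat_form q) y.
Proof.
split=> [hx q|H].
  apply: contrapT => /forall2NP H.
  have : [set z | lin (rat_form q) z < lin (rat_form q) x] x.
    apply: (conv_hull_min (@convex_lin_lt _ _) _ hx) => y /= ys.
    by have [//|/negP] := H y; rewrite ltNge.
  by rewrite /= ltxx.
apply: contrapT => /separation[q Hq]; have [y /Hq] := H q.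
by rewrite ltNge => /negbTE ->.
Qed.

(** A vertex is the unique maximizer on s of a rational form, which makes being
    a vertex a measurable condition. *)
Lemma vertices_sepP s x : vertices (conv_hull [set` s]) x <->
  x \in s /\ exists q, forall y, y \in s ->
    y = x \/ lin (rat_form q) y < lin (rat_form q) x.
Proof.
split=> [/vertex_necessary[xs nx]|[xs [q Hq]]].
  split=> //.
  have [|q Hq] := @separation [seq y <- s | y != x] x.
    apply: contra_not nx; apply: conv_hullS => y /=.
    by rewrite mem_filter => /andP[/eqP].
  exists q => y ys; have [->|yx] := eqVneq y x; first by left.
  by right; apply: Hq; rewrite mem_filter yx.
pose C := [set y | y = x \/ lin (rat_form q) y < lin (rat_form q) x].
have hC : conv_hull [set` s] `<=` C.
  apply: conv_hull_min => //; apply/convex_setP => y z t Cy Cz t01.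
  have [t0|t0] := eqVneq t 0; first by rewrite t0 scale0r add0r subr0 scale1r.
  have [t1|t1] := eqVneq t 1; first by rewrite t1 scale1r subrr scale0r addr0.
  have {t0 t1 t01}[t0 t1] : 0 < t /\ t < 1.
    by move: t01 => /andP[? ?]; rewrite !lt_neqAle t1 eq_sym t0.
  case: Cy Cz => [->|yx] [->|zx]; first by left; rewrite -scalerDl subrKC scale1r.
  - right; rewrite lin_conv.
    have : 0 < (1 - t) * (lin (rat_form q) x - lin (rat_form q) z).
      by rewrite mulr_gt0 ?subr_gt0.
    nra.
  - right; rewrite lin_conv.
    have : 0 < t * (lin (rat_form q) x - lin (rat_form q) y).
      by rewrite mulr_gt0 ?subr_gt0.
    nra.
  - right; rewrite lin_conv.
    have : 0 < t * (lin (rat_form q) x - lin (rat_form q) y).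
      by rewrite mulr_gt0 ?subr_gt0.
    nra.
split; first exact: sub_conv_hull.
move=> y z t /hC hy /hC hz /andP[t0 t1] xE.
have xl := lin_conv (rat_form q) y z t; rewrite -xE in xl.
have t1' : 0 < 1 - t by rewrite subr_gt0.
case: hy hz xl => [->|yx] [->|zx] xl //; exfalso; clear xE.
- have : 0 < (1 - t) * (lin (rat_form q) x - lin (rat_form q) z).
    by rewrite mulr_gt0 ?subr_gt0.
  nra.
- have : 0 < t * (lin (rat_form q) x - lin (rat_form q) y).
    by rewrite mulr_gt0 ?subr_gt0.
  nra.
- have : 0 < t * (lin (rat_form q) x - lin (rat_form q) y).
    by rewrite mulr_gt0 ?subr_gt0.
  nra.
Qed.

End separation.

(** * Measurability of the hull *)

Section hull_measurability.
Variable R : realType.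
Implicit Types (l : plane R).

Lemma measurable_lin l : measurable_fun setT (lin l).
Proof.
by apply: measurable_funD; apply: measurable_funM.
Qed.

Lemma measurable_le d (T : measurableType d) (f g : T -> R) :
  measurable_fun setT f -> measurable_fun setT g ->
  measurable [set x | f x <= g x].
Proof.
move=> mf mg; rewrite -[X in measurable X]setTI.
rewrite (_ : [set x | _] = (fun x => f x <= g x) @^-1` [set true]) //.
exact: measurable_fun_ler.
Qed.

Lemma measurable_lt d (T : measurableType d) (f g : T -> R) :
  measurable_fun setT f -> measurable_fun setT g ->
  measurable [set x | f x < g x].
Proof.
move=> mf mg; rewrite -[X in measurable X]setTI.
rewrite (_ : [set x | _] = (fun x => f x < g x) @^-1` [set true]) //.
exact: measurable_fun_ltr.
Qed.

Lemma measurable_plane_eq d (T : measurableType d) (f g : T -> plane R) :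
  measurable_fun setT f -> measurable_fun setT g ->
  measurable [set x | f x = g x].
Proof.
move=> mf mg.
have m1 (h : T -> plane R) : measurable_fun setT h ->
    measurable_fun setT (fun x => (h x).1 : R).
  by move=> mh; apply: (measurableT_comp measurable_fst mh).
have m2 (h : T -> plane R) : measurable_fun setT h ->
    measurable_fun setT (fun x => (h x).2 : R).
  by move=> mh; apply: (measurableT_comp measurable_snd mh).
rewrite (_ : [set x | _] =
  ([set x | ((f x).1 : R) <= (g x).1] `&` [set x | ((g x).1 : R) <= (f x).1]) `&`
  ([set x | ((f x).2 : R) <= (g x).2] `&` [set x | ((g x).2 : R) <= (f x).2])).
  by apply: measurableI; apply: measurableI; apply: measurable_le;
    [exact: m1|exact: m1|exact: m1|exact: m1|exact: m2|exact: m2|exact: m2|exact: m2].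
apply/seteqP; split=> x /=; first by move=> ->; rewrite !lexx.
by move=> [[a b] [c e]]; apply: plane_eq; apply/eqP; rewrite eq_le ?a ?c.
Qed.

Lemma measurable_forall_countable d (T : measurableType d) (I : countType)
    (F : I -> set T) :
  (forall i, measurable (F i)) -> measurable [set x | forall i, F i x].
Proof.
move=> mF; rewrite (_ : [set x | _] = ~` \bigcup_(i in setT) ~` F i).
  by apply/measurableC/countable_bigcupT_measurable => // i; exact: measurableC.
by rewrite setC_bigcup; apply/seteqP; split=> x H i; [move=> _|];
  rewrite ?setCK; [exact: H|have := H i Logic.I; rewrite setCK].
Qed.

Lemma measurable_exists_countable d (T : measurableType d) (I : countType)
    (F : I -> set T) :
  (forall i, measurable (F i)) -> measurable [set x | exists i, F i x].
Proof.
move=> mF; rewrite (_ : [set x | _] = \bigcup_(i in setT) F i).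
  exact: countable_bigcupT_measurable.
by apply/seteqP; split=> x; [move=> [i]; exists i|move=> [i _]; exists i].
Qed.

Lemma hullE N (u : N.-tuple (plane R)) : hull u = conv_hull [set` tval u].
Proof.
rewrite /hull; congr conv_hull; apply/seteqP; split=> [x [i _ <-]|x /= /tnthP[i ->]].
  exact: mem_tnth.
by exists i.
Qed.

Lemma hull_sepP N (u : N.-tuple (plane R)) x : hull u x <->
  forall q, exists i, lin (rat_form R q) x <= lin (rat_form R q) (tnth u i).
Proof.
rewrite hullE conv_hull_sepP; split=> H q; have := H q.
  by move=> [_ /tnthP[i ->] ?]; exists i.
by move=> [i ?]; exists (tnth u i) => //; exact: mem_tnth.
Qed.

Lemma measurable_hull_graph N d (T : measurableType d) (f : T -> plane R)
    (g : T -> N.-tuple (plane R)) :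
  measurable_fun setT f -> measurable_fun setT g ->
  measurable [set z | hull (g z) (f z)].
Proof.
move=> mf mg.
rewrite (_ : [set z | _] = [set z | forall q, exists i,
   lin (rat_form R q) (f z) <= lin (rat_form R q) (tnth (g z) i)]); last first.
  by apply/seteqP; split=> z /hull_sepP.
apply: measurable_forall_countable => q; apply: measurable_exists_countable => i.
apply: measurable_le; first exact: (measurableT_comp (measurable_lin _) mf).
have mgi : measurable_fun setT (fun z => tnth (g z) i).
  exact: (measurableT_comp (measurable_tnth i) mg).
exact: (measurableT_comp (measurable_lin _) mgi).
Qed.

Lemma measurable_hull N (u : N.-tuple (plane R)) : measurable (hull u).
Proof.
rewrite (_ : hull u = [set x | hull u x])//.
by apply: (@measurable_hull_graph _ _ _ id (fun=> u)).
Qed.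

End hull_measurability.

(** * Area of homothetic copies of a convex body *)

Section area.
Variable R : realType.
Implicit Types (l : plane R).

Lemma lebesgue_measure_affine (a r : R) (A : set (measurableTypeR R)) : 0 < r ->
  measurable A -> lebesgue_measure A = (r%:E * lebesgue_measure
    ((fun x : measurableTypeR R => (a + r * x : measurableTypeR R)%R) @^-1` A))%E.
Proof.
move=> r0 mA; pose f := fun x : measurableTypeR R => (a + r * x : measurableTypeR R)%R.
have mf : measurable_fun setT f.
  by apply: measurable_funD => //; apply: measurable_funM.
have := @lebesgue_measure_unique R
  (mscale (NngNum (ltW r0)) (pushforward lebesgue_measure f)).
apply => // _ [[b c] _ <-].
have fE : f @^-1` `]b, c]%classic = `](b - a) / r, (c - a) / r]%classic.
  apply/seteqP; split=> x /=; rewrite !in_itv/= /f.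
    by rewrite ltr_pdivrMr// ler_pdivlMr//; move=> /andP[? ?]; apply/andP; split; lra.
  by rewrite ltr_pdivrMr// ler_pdivlMr//; move=> /andP[? ?]; apply/andP; split; lra.
change (lebesgue_measure `]b, c]%classic =
  (r%:E * lebesgue_measure (f @^-1` `]b, c]%classic))%E).
rewrite fE !lebesgue_measure_itv/= !lte_fin ltr_pM2r ?invr_gt0// ltrD2r.
case: ifP => _; last by rewrite mule0.
rewrite -!EFinD -EFinM; congr EFin; field; lra.
Qed.

Lemma area_box (A B : set (measurableTypeR R)) : measurable A -> measurable B ->
  area (A `*` B) = (lebesgue_measure A * lebesgue_measure B)%E.
Proof. by move=> mA mB; exact: product_measure1E. Qed.

Lemma measurable_homothety (x : plane R) (r : R) :
  measurable_fun setT (fun z : plane R => x + r *: z).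
Proof.
apply/measurable_fun_pairP; split.
  by apply: measurable_funD => //; apply: measurable_funM.
by apply: measurable_funD => //; apply: measurable_funM.
Qed.

(** Rectangles determine a measure on the plane. *)
Lemma area_homothety (x : plane R) (r : R) (A : set (plane R)) : 0 < r -> measurable A ->
  area ((fun z => x + r *: z) @^-1` A) = ((r ^- 2)%:E * area A)%E.
Proof.
move=> r0 mA; pose f : plane R -> plane R := fun z => x + r *: z.
have mf : measurable_fun setT f := measurable_homothety x r.
suff -> : area A = (r%:E * (r%:E * area (f @^-1` A)))%E.
  rewrite !muleA -!EFinM (_ : r ^- 2 * r * r = 1) ?mul1e//.
  by field; lra.
rewrite muleA -EFinM.
have r20 : 0 <= r * r by rewrite mulr_ge0 ?ltW.
have := @product_measure_unique _ _ _ _ R lebesgue_measure lebesgue_measure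
  (mscale (NngNum r20) (pushforward area f)).
apply => // B C mB mC.
pose g (a : R) := fun z : measurableTypeR R => (a + r * z : measurableTypeR R)%R.
change ((r * r)%:E * area ((g x.1 @^-1` B) `*` (g x.2 @^-1` C)) =
  lebesgue_measure B * lebesgue_measure C)%E.
have mA1 (a : R) (D : set (measurableTypeR R)) : measurable D ->
    measurable (g a @^-1` D).
  move=> mD; rewrite -[X in measurable X]setTI.
  by apply: measurable_funD => //; apply: measurable_funM.
rewrite !area_box//; [|exact: mA1|exact: mA1].
rewrite [in RHS](lebesgue_measure_affine x.1 r0 mB).
rewrite [in RHS](lebesgue_measure_affine x.2 r0 mC).
by rewrite EFinM muleACA.
Qed.

Lemma area_line l (k : R) : l != 0 -> area [set z | lin l z = k] = 0%E.
Proof.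
move=> l0; have [l2|l2] := eqVneq (l.2 : R) 0.
  have l1 : l.1 != 0 :> R.
    by apply: contra l0 => /eqP l1; apply/eqP/plane_eq.
  rewrite (_ : [set z | _] = [set (k / l.1 : measurableTypeR R)%R] `*` setT); last first.
    apply/seteqP; split=> z /=; rewrite /lin l2 mul0r addr0.
      by move=> <-; split=> //; rewrite mulrC mulKf.
    by move=> [-> _]; rewrite mulrC divfK.
  by rewrite area_box// lebesgue_measure_set1 mul0e.
set S := [set z | _].
have -> : area S = (\int[lebesgue_measure]_x (lebesgue_measure \o xsection S) x)%E.
  by [].
rewrite integral0_eq// => x _ /=.
rewrite (_ : xsection _ _ = [set ((k - (l.1 : R) * x) / l.2 : measurableTypeR R)%R]).
  exact: lebesgue_measure_set1.
apply/seteqP; split=> y; rewrite /xsection /= inE /= /lin /=.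
  by move=> <-; rewrite addrC addKr mulrC mulKf.
move=> ->; have e (t : R) : (l.2 : R) * (t / (l.2 : R)) = t by rewrite mulrC divfK.
change ((l.1 : R) * (x : R) + (l.2 : R) * ((k - (l.1 : R) * x) / (l.2 : R)) = k).
by rewrite e subrKC.
Qed.

End area.

Section convex_body.
Variables (R : realType) (K : set (plane R)).
Hypotheses (cK : compact K) (vK : convex_set K) (aK : area K = 1%E).
Implicit Types (x y z : plane R).

Let mK : measurable K := compact_measurable_plane cK.

Lemma ball_plane x y (e : R) :
  ball x e y <-> `|x.1 - y.1 : R| < e /\ `|x.2 - y.2 : R| < e.
Proof.
split=> -[]; first by rewrite -!ball_normE.
by split; rewrite /= -ball_normE.
Qed.

Lemma bounded_body : exists2 M : R, 0 < M & forall x y, K x -> K y ->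
  `|x.1 - y.1 : R| <= M /\ `|x.2 - y.2 : R| <= M.
Proof.
have [M [Mr HM]] := compact_bounded cK.
have b x : K x -> `|x.1 : R| <= `|M| + 1 /\ `|x.2 : R| <= `|M| + 1.
  move=> Kx; have := HM (`|M| + 1) _ x Kx.
  rewrite (le_lt_trans (ler_norm _)) ?ltrDl// => /(_ isT).
  change (Num.max `|x.1 : R| `|x.2 : R| <= `|M| + 1 ->
    `|x.1 : R| <= `|M| + 1 /\ `|x.2 : R| <= `|M| + 1).
  by rewrite ge_max => /andP.
exists ((`|M| + 1) + (`|M| + 1)); first by rewrite addr_gt0// ltr_wpDl.
move=> x y /b[x1 x2] /b[y1 y2].
by split; rewrite (le_trans (ler_normB _ _))// lerD.
Qed.

(** The image of K under the homothety of center x and ratio s, written as a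
    preimage so that its measurability is immediate. *)
Definition shrink x (s : R) : set (plane R) :=
  [set z | K ((x - s^-1 *: x) + s^-1 *: z)].

Lemma shrinkP x (s : R) z : 0 < s < 1 -> shrink x s z ->
  exists2 k, K k & z = s *: k + (1 - s) *: x.
Proof.
move=> /andP[s0 s1] Kz; eexists; first exact: Kz.
by apply: plane_eq; rewrite !planeE; field; lra.
Qed.

Lemma shrink_sub x (s : R) : K x -> 0 < s < 1 -> shrink x s `<=` K.
Proof.
move=> Kx s01 z /(shrinkP s01)[k Kk ->].
move/convex_setP: vK; apply => //.
by move/andP: s01 => [? ?]; rewrite !ltW.
Qed.

Lemma uniform_shrink x (s : R) : K x -> 0 < s < 1 ->
  measurable (shrink x s) /\ uniform_law cK aK (shrink x s) = (s ^+ 2)%:E.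
Proof.
move=> Kx /[dup] s01 /andP[s0 s1]; have si0 : 0 < s^-1 by rewrite invr_gt0.
split.
  by rewrite -[X in measurable X]setTI; apply: measurable_homothety.
rewrite /uniform_law /mrestr setIidl; last exact: shrink_sub.
by rewrite area_homothety// aK mule1 exprVn invrK.
Qed.

Lemma body_nonempty : exists x, K x.
Proof.
apply: contrapT => /forallNP nK.
move: aK; rewrite (_ : K = set0) ?measure0; last by apply/seteqP; split.
by move/eqP; rewrite eqe eq_sym oner_eq0.
Qed.

(** A convex set of positive area is not contained in a line, hence contains a
    non-degenerate triangle, hence a box around the centroid of the triangle. *)
Lemma body_interior : exists2 p, K p & exists2 r : R, 0 < r &
  forall z, `|z.1 - p.1 : R| <= r -> `|z.2 - p.2 : R| <= r -> K z.
Proof.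
have [a Ka] := body_nonempty.
have noline l : l != 0 -> exists2 z, K z & lin l z != lin l a.
  move=> l0; apply: contrapT => /forall2NP H.
  have sub : K `<=` [set z | lin l z = lin l a].
    by move=> z Kz /=; have [//|/negP/negPn/eqP] := H z.
  have : (area K <= area [set z | lin l z = lin l a])%E.
    apply: le_measure => //; rewrite inE//.
    rewrite (_ : [set z | _] = lin l @^-1` [set lin l a])//.
    by rewrite -[X in measurable X]setTI; apply: measurable_lin.
  by rewrite area_line// aK lee_fin ler10.
have [|b Kb ba] := noline (1, 0).
  by apply/eqP => -[] /eqP; rewrite oner_eq0.
have ba0 : quarter_turn (b - a) != 0.
  apply: contra ba => /eqP; rewrite /quarter_turn => -[/eqP b2 /eqP b1].
  move: b2 b1; rewrite oppr_eq0 !subr_eq0 => /eqP b2 /eqP b1.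
  by rewrite (plane_eq b1 b2).
have [c Kc ca] := noline _ ba0.
pose D := cross (b - a) (c - a).
have D0 : D != 0.
  apply: contra ca; rewrite /D -lin_quarter_turn linB subr_eq0 //.
pose p := 3^-1 *: (a + b + c).
(* In the frame of origin p and axes b - a and c - a, the coordinates of a point
   whose distance to p is at most r are bounded by 1/6 thanks to Cramer's rule,
   so its barycentric coordinates are nonnegative. *)
pose m := `|(b - a).1 : R| + `|(b - a).2 : R| + `|(c - a).1 : R| + `|(c - a).2 : R| + 1.
have m0 : 0 < m by rewrite ltr_wpDl// !addr_ge0.
pose r := `|D| / (6 * m).
have r0 : 0 < r by rewrite divr_gt0 ?normr_gt0// mulr_gt0.
have box z : `|z.1 - p.1 : R| <= r -> `|z.2 - p.2 : R| <= r -> K z.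
  move=> z1 z2.
  pose al := cross (z - p) (c - a) / D.
  pose be := cross (b - a) (z - p) / D.
  have bound (e f g h : R) : `|e| <= r -> `|f| <= r -> `|g| + `|h| <= m ->
      `|(e * g - f * h) / D| <= 6^-1.
    move=> er fr gh; rewrite normrM normfV ler_pdivrMr ?normr_gt0//.
    rewrite (le_trans (ler_normB _ _))// !normrM.
    rewrite (@le_trans _ _ (r * (`|g| + `|h|)))//.
      by rewrite mulrDr lerD// ler_wpM2r.
    rewrite (@le_trans _ _ (r * m))// ?ler_pM2l//.
    by rewrite /r le_eqVlt; apply/orP; left; apply/eqP; field; rewrite gt_eqF.
  have hal : `|al| <= 6^-1.
    by rewrite /al /cross; apply: bound => //; rewrite /m !planeE; 
      have := normr_ge0 ((b - a).1 : R); have := normr_ge0 ((b - a).2 : R);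
      rewrite !planeE; lra.
  have hbe : `|be| <= 6^-1.
    have -> : be = (((z - p).2 : R) * (b - a).1 - ((z - p).1 : R) * (b - a).2) / D.
      by rewrite /be /cross; congr (_ / _); ring.
    by apply: bound => //; rewrite /m !planeE; 
      have := normr_ge0 ((c - a).1 : R); have := normr_ge0 ((c - a).2 : R);
      rewrite !planeE; lra.
  move: hal hbe; rewrite !ler_norml => /andP[al1 al2] /andP[be1 be2].
  have q0 : 3^-1 - al - be != 1.
    lra.
  (* the barycentric coordinates of z are 1/3 - al - be, 1/3 + al, 1/3 + be *)
  have -> : z = (3^-1 - al - be) *: a + (1 - (3^-1 - al - be)) *:
      (((3^-1 + al) / (1 - (3^-1 - al - be))) *: b +
       (1 - (3^-1 + al) / (1 - (3^-1 - al - be))) *: c).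
    have q1 : 1 - (3^-1 - al - be) != 0 by lra.
    have e (a' b' c' z' : R) : z' = 3^-1 * (a' + b' + c') + al * (b' - a') + be * (c' - a') ->
      z' = (3^-1 - al - be) * a' + (1 - (3^-1 - al - be)) *
      (((3^-1 + al) / (1 - (3^-1 - al - be))) * b' +
       (1 - (3^-1 + al) / (1 - (3^-1 - al - be))) * c').
      by move=> ->; field; lra.
    have D0' := D0; rewrite /D /cross !planeE in D0'.
    apply: (@plane_eq R); rewrite !planeE; apply: e;
      by rewrite /al /be /D /cross /p !planeE; field.
  have /convex_setP cvx := vK; apply: (cvx) => //; last by apply/andP; split; lra.
  apply: (cvx) => //; apply/andP; split; first by rewrite divr_ge0//; lra.
  by rewrite ler_pdivrMr; lra.
exists p; last by exists r.
by apply: box; rewrite subrr normr0 ltW.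
Qed.

(** K contains a copy of itself shrunk towards x inside any ball centered at
    x, so a set that misses such a ball misses a fixed proportion of K. *)
Lemma far_hull_deficit (e : R) : 0 < e -> exists c : R, 0 <= c < 1 /\
  forall C, measurable C ->
    (exists2 x, K x & forall y, C y -> ~ ball x e y) ->
    (uniform_law cK aK C <= c%:E)%E.
Proof.
move=> e0; have [M M0 HM] := bounded_body.
(* M bounds the coordinates of differences of points of K, so K shrunk by a
   ratio s with s * M < e fits into a ball of radius e *)
pose s := e / (M + e).
have Me0 : 0 < M + e by rewrite addr_gt0.
have s0 : 0 < s by rewrite divr_gt0.
have s1 : s < 1 by rewrite ltr_pdivrMr// mul1r ltrDr.
have sM : s * M < e.
  by rewrite /s mulrAC ltr_pdivrMr// ltr_pM2l// ltrDl.
have s01 : 0 < s < 1 by rewrite s0.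
exists (1 - s ^+ 2); split.
  by rewrite subr_ge0 expr_le1 ?ltW//= gtrBl exprn_gt0.
move=> C mC [x Kx Cx]; have [mS US] := uniform_shrink Kx s01.
rewrite EFinB -US -probability_setC//.
apply: le_measure; rewrite ?inE//; first exact: measurableC.
move=> y Cy /(shrinkP s01)[k Kk yE]; apply: (Cx y Cy).
have [d1 d2] := HM _ _ Kx Kk.
apply/ball_plane; rewrite yE !planeE; split.
  rewrite (_ : _ - _ = s * ((x.1 : R) - k.1)); last by ring.
  by rewrite normrM (gtr0_norm s0) (le_lt_trans _ sM)// ler_pM2l.
rewrite (_ : _ - _ = s * ((x.2 : R) - k.2)); last by ring.
by rewrite normrM (gtr0_norm s0) (le_lt_trans _ sM)// ler_pM2l.
Qed.

(** Let the box of half-side r around p lie in K. If z is in the copy of K shrunk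
    towards p with ratio s, then the box of half-side (1 - s) r around z lies in
    K by convexity. If a line separated z from the polygon, the corner of this
    box farthest beyond the line would be at distance larger than (1 - s) r from
    the polygon; so the polygon contains the copy, whose area is s ^ 2. *)
Lemma near_hull_area (c : R) : c < 1 -> exists2 e : R, 0 < e &
  forall N (u : N.-tuple (plane R)),
    (forall x, K x -> exists2 y, hull u y & ball x e y) ->
    (c%:E < uniform_law cK aK (hull u))%E.
Proof.
move=> c1; have [p Kp [r r0 Hr]] := body_interior.
have [s s01 cs] : exists2 s : R, 0 < s < 1 & c < s ^+ 2.
  (* (3 + c) ^ 2 - 16 c = (1 - c) (9 - c) *)
  exists ((3 + Num.max c 0) / 4).
    have : Num.max c 0 < 1 by rewrite gt_max c1 ltr01.
    have : 0 <= Num.max c 0 by rewrite le_max lexx orbT.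
    by move=> ? ?; apply/andP; split; lra.
  have : Num.max c 0 < 1 by rewrite gt_max c1 ltr01.
  have : 0 <= Num.max c 0 by rewrite le_max lexx orbT.
  have : c <= Num.max c 0 by rewrite le_max lexx.
  move: (Num.max c 0) => m; nra.
move: (s01) => /andP[s0 s1].
exists ((1 - s) * r); first by rewrite mulr_gt0// subr_gt0.
move=> N u Hu; have [mS US] := uniform_shrink Kp s01.
apply: (@lt_le_trans _ _ (s ^+ 2)%:E); first by rewrite lte_fin.
rewrite -US; apply: le_measure; rewrite ?inE//; first exact: measurable_hull.
move=> z /(shrinkP s01)[k Kk zE]; apply: contrapT => nz.
have [q Hq] : exists q, forall y, hull u y -> lin (rat_form R q) y < lin (rat_form R q) z.
  move: nz; rewrite hullE => /separation[q Hq]; exists q.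
  exact: (conv_hull_min (@convex_lin_lt _ _ _)).
set l := rat_form R q in Hq.
(* the corner of the box around p that maximizes l *)
pose w : plane R := (p.1 + r * Num.sg (l.1 : R), p.2 + r * Num.sg (l.2 : R)).
have sg1 (t : R) : `|Num.sg t| <= 1 by rewrite normr_sg; case: (_ != _).
have Kw : K w.
  by apply: Hr; rewrite /w /= addrC addKr normrM (gtr0_norm r0) ger_pMr.
have Kv : K (s *: k + (1 - s) *: w).
  by move/convex_setP: vK; apply => //; rewrite !ltW.
have [y /Hq yz /ball_plane[d1 d2]] := Hu _ Kv.
have Ev : lin l (s *: k + (1 - s) *: w) = lin l z + (1 - s) * r * (`|l.1 : R| + `|l.2 : R|).
  rewrite zE /lin !planeE /w /= !normrEsg.
  ring.
have : lin l (s *: k + (1 - s) *: w) - lin l y <= (1 - s) * r * (`|l.1 : R| + `|l.2 : R|).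
  rewrite -linB /lin [leRHS]mulrDr; apply: lerD.
    by rewrite (le_trans (ler_norm _))// normrM mulrC ler_wpM2r// ltW.
  by rewrite (le_trans (ler_norm _))// normrM mulrC ler_wpM2r// ltW.
rewrite Ev; lra.
Qed.

End convex_body.

(** * Independent identically distributed points *)

Section product.
Context d1 d2 (T1 : measurableType d1) (T2 : measurableType d2) (R : realType).

(** The integral of a nonnegative function is a supremum over the simple
    functions below it, measurable or not. *)
Lemma le_integral_nonmeasurable (mu : {measure set T1 -> \bar R}) (f g : T1 -> \bar R) :
  (forall x, 0 <= f x)%E -> (forall x, f x <= g x)%E ->
  (\int[mu]_x f x <= \int[mu]_x g x)%E.
Proof.
move=> f0 fg; rewrite !ge0_integralTE//; last first.
  by move=> x; exact: le_trans (f0 x) (fg x).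
apply: ge_ereal_sup => _ [h hf <-]; apply: ereal_sup_ubound.
by exists h => // x; exact: le_trans (hf x) (fg x).
Qed.

Lemma product_measureC (m1 : {sigma_finite_measure set T1 -> \bar R})
    (m2 : {sigma_finite_measure set T2 -> \bar R}) (A : set (T1 * T2)) :
  measurable A -> (m1 \x m2)%E A = (\int[m2]_y m1 (ysection A y))%E.
Proof.
move=> mA; rewrite (@product_measure_unique _ _ _ _ _ m1 m2 (m1 \x^ m2)%E)//.
by move=> B C mB mC; exact: product_measure2E.
Qed.

End product.

Section iid.
Context d (T : measurableType d) (R : realType) (P : probability T R).
Implicit Types n : nat.

(** The law is monotone on all sets, because so are the iterated integrals that
    define it. This spares a proof that the events on the Hausdorff distance
    are measurable: they only need to be compared with measurable events. *)
Lemma le_iid_law n (A B : set (n.-tuple T)) : A `<=` B ->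
  (iid_law P n A <= iid_law P n B)%E.
Proof.
elim: n A B => [|n IH] A B AB /=.
  rewrite !diracE lee_fin ler_nat.
  by have [/set_mem/AB/mem_set->|] := boolP (_ \in A).
apply: le_integral_nonmeasurable => x; first exact: measure_ge0.
by apply: IH => v; rewrite /xsection /= !inE; exact: AB.
Qed.

Lemma measurable_tuple_cons n : measurable_fun setT (@tuple_cons _ T n).
Proof. exact: measurable_cons measurable_fst measurable_snd. Qed.

Lemma iid_law_cons n (A : set (n.+1.-tuple T)) : measurable A ->
  iid_law P n.+1 A =
  (\int[iid_law P n]_v P [set x | A [tuple of x :: v]])%E.
Proof.
move=> mA; have mA' : measurable (@tuple_cons _ T n @^-1` A).
  by rewrite -[X in measurable X]setTI; apply: measurable_tuple_cons.
transitivity ((P \x iid_law P n)%E (@tuple_cons _ T n @^-1` A)); first by [].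
rewrite product_measureC//; apply: eq_integral => v _.
by congr (P _); apply/seteqP; split=> x; rewrite /ysection /= inE.
Qed.

Definition box n (A : 'I_n -> set T) : set (n.-tuple T) :=
  [set u | forall i, A i (tnth u i)].

Lemma measurable_box n (A : 'I_n -> set T) :
  (forall i, measurable (A i)) -> measurable (box A).
Proof.
move=> mA; apply: measurable_forall_countable => i.
rewrite -[X in measurable X]setTI.
exact: (measurable_tnth i measurableT (mA i)).
Qed.

Lemma iid_law_box n (A : 'I_n -> set T) : (forall i, measurable (A i)) ->
  iid_law P n (box A) = (\prod_(i < n) fine (P (A i)))%:E.
Proof.
elim: n A => [|n IH] A mA.
  rewrite big_ord0 (_ : box A = setT) ?probability_setT//.
  by apply/seteqP; split=> u // _ [].
transitivity ((P \x iid_law P n)%E (A ord0 `*` box (fun i => A (lift ord0 i)))).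
  rewrite [LHS]/=; congr (_ _); apply/seteqP; split=> -[x v] /=.
    move=> H; split; first by have := H ord0.
    by move=> i; have := H (lift ord0 i); rewrite tnthS.
  by move=> [Ax Av] i; have [j ->|->//] := unliftP ord0 i; rewrite tnthS; apply: Av.
have mb : measurable (box (fun i => A (lift ord0 i))).
  by apply: measurable_box => i; exact: mA.
transitivity (P (A ord0) * iid_law P n (box (fun i => A (lift ord0 i))))%E.
  exact: product_measure1E.
rewrite (IH _ (fun i => mA _)) big_ord_recl EFinM fineK//.
exact: fin_num_measure.
Qed.

Definition permute_tuple n (s : 'S_n) (u : n.-tuple T) : n.-tuple T :=
  [tuple tnth u (s i) | i < n].

Lemma measurable_permute n (s : 'S_n) : measurable_fun setT (@permute_tuple n s).
Proof.
apply/measurable_fun_tnthP => i.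
rewrite (_ : _ \o _ = fun u => tnth u (s i)); first exact: measurable_tnth.
by apply/funext => u /=; rewrite tnth_mktuple.
Qed.

Lemma measurable_permute_preimage n (s : 'S_n) (A : set (n.-tuple T)) :
  measurable A -> measurable (permute_tuple s @^-1` A).
Proof.
by move=> mA; rewrite -[X in measurable X]setTI; apply: measurable_permute.
Qed.

(** Both laws give a box the product of the probabilities of its sides, and
    boxes are stable under intersection and generate the events. *)
Lemma iid_law_exchangeable n (s : 'S_n) (A : set (n.-tuple T)) : measurable A ->
  iid_law P n (permute_tuple s @^-1` A) = iid_law P n A.
Proof.
move=> mA; pose G := [set B | exists2 F : 'I_n -> set T,
  (forall i, measurable (F i)) & B = box F].
have GT : G setT.
  by exists (fun=> setT) => //; apply/seteqP; split.
have ms := @measurable_permute n s.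
have mG : measurable = <<s G >>.
  rewrite eqEsubset; split.
    apply: smallest_sub; first exact: smallest_sigma_algebra.
    move=> B; rewrite -bigcup_seq => -[i _] [C mC <-]; rewrite setTI.
    apply: sub_sigma_algebra; exists (fun j => if j == i then C else setT).
      by move=> j; case: ifP.
    apply/seteqP; split=> u /=; last by move/(_ i); rewrite eqxx.
    by move=> Cu j; case: eqP => [->|].
  apply: smallest_sub; first exact: sigma_algebra_measurable.
  by move=> B [F mF ->]; exact: measurable_box.
apply/esym; change (iid_law P n A = pushforward (iid_law P n) (permute_tuple s) A).
apply: (measure_unique G (fun=> setT)) => //.
- move=> _ _ [F mF ->] [H mH ->]; exists (fun i => F i `&` H i).
    by move=> i; exact: measurableI.
  by apply/seteqP; split=> u; [move=> [? ?] i|move=> FH; split=> i; have [] := FH i].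
- by apply/seteqP; split=> // u _; exists 0%N.
- move=> _ [F mF ->].
  transitivity (iid_law P n (box (fun j => F ((s^-1)%g j)))).
    apply: eq_trans (esym (iid_law_box (fun j => mF _))).
    apply: eq_trans (iid_law_box mF) _; congr EFin.
    exact: (reindex_inj (@perm_inj _ (s^-1)%g)).
  congr (iid_law P n _); apply/seteqP; split=> u H i.
    by have := H (s i); rewrite permK tnth_mktuple.
  by have := H ((s^-1)%g i); rewrite tnth_mktuple permKV.
- move=> _; exact: (le_lt_trans (probability_le1 (iid_law P n) measurableT) (ltry 1)).
Qed.

End iid.

(** * Counting the vertices of the hull *)

Lemma card_image_finset (I : finType) (T : Type) (f : I -> T) (B : {set I}) n :
  {in B &, injective f} ->
  (f @` [set` B] #= `I_n)%card <-> #|B| = n.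
Proof.
move=> fB.
have E : (f @` [set` B] #= `I_#|B|)%card.
  have E1 : (f @` [set` B] #= [set` B])%card.
    by apply: inj_card_eq => i j; rewrite !inE; exact: fB.
  apply: card_eq_trans E1 _; rewrite card_eq_sym.
  apply: card_eq_trans card_II _; rewrite card_eq_sym.
  rewrite (_ : [set` B] = (@enum_val I (mem B)) @` setT).
    by apply: inj_card_eq => i j _ _; exact: enum_val_inj.
  apply/seteqP; split=> [i /= iB|_ [i _ <-] /=]; last exact: enum_valP.
  by exists (enum_rank_in iB i) => //; rewrite enum_rankK_in.
split=> [E'|<-//].
by apply/card_eq_II; rewrite -(card_eql E).
Qed.

Lemma measurable_card_set d (T : measurableType d) (I : finType)
    (F : I -> set T) n : (forall i, measurable (F i)) ->
  measurable [set x | #|[set i | `[< F i x >]]%SET| = n].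
Proof.
move=> mF.
rewrite (_ : [set x | _] = [set x | exists B : {set I}, (#|B| == n) /\
    forall i, if i \in B then F i x else ~ F i x]).
  apply: measurable_exists_countable => B; case: (#|B| == n); last first.
    by rewrite [X in measurable X](_ : _ = set0)//; apply/seteqP; split=> x // [].
  rewrite [X in measurable X](_ : _ = [set x | forall i, if i \in B then F i x else ~ F i x]).
    apply: measurable_forall_countable => i; case: (i \in B) => //.
    exact: measurableC.
  by apply/seteqP; split=> x /=; [case|].
apply/seteqP; split=> x /=.
  move=> <-; eexists; split; first exact: eqxx.
  by move=> i; rewrite inE; case: asboolP.
move=> [B [/eqP <- HB]]; congr #|pred_of_set _|; apply/setP => i; rewrite inE.
by have := HB i; case: ifP => _; case: asboolP.
Qed.

Section vertices.
Variables (R : realType).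
Implicit Types (N n : nat).

(** Several points of the tuple may coincide: a vertex is represented by the
    first index at which it occurs. *)
Definition vertex_index N (u : N.-tuple (plane R)) (i : 'I_N) : Prop :=
  vertices (hull u) (tnth u i) /\
  forall j : 'I_N, (j < i)%N -> tnth u j <> tnth u i.

Lemma n_verticesE n N (u : N.-tuple (plane R)) : n_vertices n u <->
  #|[set i | `[< vertex_index u i >]]%SET| = n.
Proof.
rewrite -(@card_image_finset _ _ (tnth u)); last first.
  move=> i j; rewrite !inE => -[_ Hi] [_ Hj] e.
  apply/val_inj; case: (ltngtP i j) => // ij; first by case: (Hj _ ij).
  by case: (Hi _ ij).
suff E : vertices (hull u) =
    tnth u @` [set` [set i | `[< vertex_index u i >]]%SET].
  by rewrite /n_vertices /= E.
apply/seteqP; split=> [x vx|_ [i /= + <-]]; last first.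
  by rewrite inE => /asboolP[].
have /tnthP[i0 xi0] : x \in tval u.
  by move: vx; rewrite hullE => /vertices_sepP[].
have [|i1 /eqP ui1 Hi1] := @arg_minnP _ i0 (fun i => tnth u i == x) val.
  by rewrite -xi0.
exists i1 => //=; rewrite inE; apply/asboolP; split; first by rewrite ui1.
by move=> j ji; rewrite ui1 => /eqP/Hi1; rewrite leqNgt ji.
Qed.

Lemma measurable_vertex_index N (i : 'I_N) :
  measurable [set u : N.-tuple (plane R) | vertex_index u i].
Proof.
rewrite (_ : [set u | _] =
  [set u | exists q, forall j, tnth u j = tnth u i \/
    lin (rat_form R q) (tnth u j) < lin (rat_form R q) (tnth u i)] `&`
  [set u | forall j : 'I_N, (j < i)%N -> tnth u j <> tnth u i]).
  have mt (j : 'I_N) : measurable_fun setT (fun u : N.-tuple (plane R) => tnth u j).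
    exact: measurable_tnth.
  have meq (j : 'I_N) : measurable [set u : N.-tuple (plane R) | tnth u j = tnth u i].
    exact: measurable_plane_eq.
  apply: measurableI.
    apply: measurable_exists_countable => q.
    apply: measurable_forall_countable => j.
    rewrite [X in measurable X](_ : _ = [set u : N.-tuple (plane R) | tnth u j = tnth u i] `|`
     [set u | lin (rat_form R q) (tnth u j) < lin (rat_form R q) (tnth u i)]) //.
    apply: measurableU => //; apply: measurable_lt.
      exact: (measurableT_comp (measurable_lin _) (mt j)).
    exact: (measurableT_comp (measurable_lin _) (mt i)).
  apply: measurable_forall_countable => j; case: (j < i)%N.
    rewrite [X in measurable X](_ : _ = ~` [set u : N.-tuple (plane R) | tnth u j = tnth u i]).
      exact: measurableC.
    by apply/seteqP; split=> u /=; [apply|].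
  by rewrite [X in measurable X](_ : _ = setT)//; apply/seteqP; split.
apply/seteqP; split=> u /= [].
  rewrite hullE => /vertices_sepP[_ [q Hq]] H; split=> //.
  by exists q => j; apply: Hq; exact: mem_tnth.
move=> [q Hq] H; split=> //; rewrite hullE; apply/vertices_sepP.
split; first exact: mem_tnth.
by exists q => _ /tnthP[j ->]; exact: Hq.
Qed.

Lemma measurable_n_vertices n N : measurable (@n_vertices R n N).
Proof.
rewrite (_ : @n_vertices R n N = [set u : N.-tuple (plane R) |
    #|[set i | `[< vertex_index u i >]]%SET| = n]).
  exact: (measurable_card_set _ (@measurable_vertex_index N)).
by apply/seteqP; split=> u /n_verticesE.
Qed.

Definition redundant N (u : N.-tuple (plane R)) (i : 'I_N) : Prop :=
  conv_hull (tnth u @` [set j | j != i]) (tnth u i).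

(** Distinctness matters: both copies of a repeated vertex are redundant. *)
Lemma redundant_vertices N (u : N.-tuple (plane R)) (i : 'I_N) :
  injective (tnth u) -> redundant u i <-> ~ vertices (hull u) (tnth u i).
Proof.
move=> uI.
have E : range (tnth u) `\ tnth u i = tnth u @` [set j | j != i].
  apply/seteqP; split=> [_ [[j _ <-] ji]|_ [j /= ji <-]].
    by exists j => //=; apply/eqP => e; apply: ji; rewrite e.
  by split; [exists j|move/uI => e; rewrite e eqxx in ji].
split=> [ri /vertex_necessary[_]|nv]; first by rewrite E.
apply: contrapT => nr; apply: nv; rewrite hullE; apply/vertices_sepP.
split; first exact: mem_tnth.
have [|q Hq] := @separation R [seq tnth u j | j <- enum 'I_N & j != i] (tnth u i).
  apply: contra_not nr; apply: conv_hullS => _ /= /mapP[j + ->].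
  by rewrite mem_filter => /andP[ji _]; exists j.
exists q => _ /tnthP[j ->]; have [->|ji] := eqVneq j i; first by left.
right; apply: Hq; apply/mapP; exists j => //.
by rewrite mem_filter ji mem_enum.
Qed.

Lemma card_redundant n N (u : N.-tuple (plane R)) :
  injective (tnth u) -> n_vertices n u ->
  #|[set i | `[< redundant u i >]]%SET| = (N - n)%N.
Proof.
move=> uI /n_verticesE nE.
have E : [set i | `[< vertex_index u i >]]%SET =
    (~: [set i | `[< redundant u i >]])%SET.
  apply/setP => i; rewrite !inE; apply/asboolP/asboolPn.
    by move=> [vi _] /(redundant_vertices i uI); apply.
  move=> nr; split.
    by apply: contrapT => nv; apply: nr; apply/redundant_vertices.
  by move=> j ji /uI e; rewrite e ltnn in ji.
have := cardsC [set i | `[< redundant u i >]]%SET.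
by rewrite -E nE card_ord => /(congr1 (subn^~ n)); rewrite addnK.
Qed.

Lemma hull_permute N (s : 'S_N) (u : N.-tuple (plane R)) :
  hull (permute_tuple s u) = hull u.
Proof.
rewrite /hull; congr conv_hull; apply/seteqP; split=> _ [i _ <-].
  by rewrite tnth_mktuple; exists (s i).
by exists ((s^-1)%g i) => //; rewrite tnth_mktuple permKV.
Qed.

Lemma redundant_permute N (s : 'S_N) (u : N.-tuple (plane R)) (i : 'I_N) :
  redundant (permute_tuple s u) i <-> redundant u (s i).
Proof.
rewrite /redundant tnth_mktuple (_ : _ @` _ = tnth u @` [set j | j != s i])//.
apply/seteqP; split=> _ [j /= ji <-].
  by rewrite tnth_mktuple; exists (s j) => //=; rewrite (inj_eq perm_inj).
exists ((s^-1)%g j); last by rewrite tnth_mktuple permKV.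
by rewrite /= -(inj_eq (@perm_inj _ s)) permKV.
Qed.

Lemma redundant_cons N x (v : N.-tuple (plane R)) :
  redundant [tuple of x :: v] ord0 <-> hull v x.
Proof.
rewrite /redundant tnth0 /hull (_ : _ @` _ = range (tnth v))//.
apply/seteqP; split=> [_ [j /= j0 <-]|_ [j _ <-]].
  have [j' ->|e] := unliftP ord0 j; last by rewrite e eqxx in j0.
  by rewrite tnthS; exists j'.
by exists (lift ord0 j) => //; rewrite tnthS.
Qed.

Lemma hull_cons N x (v : N.-tuple (plane R)) : hull v x ->
  hull [tuple of x :: v] = hull v.
Proof.
move=> hx; rewrite /hull -(conv_hull_absorb hx); congr conv_hull.
apply/seteqP; split=> [_ [i _ <-]|y].
  by have [j ->|->] := unliftP ord0 i; [right; rewrite tnthS; exists j|left; rewrite tnth0].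
move=> [->|[j _ <-]]; first by exists ord0 => //; rewrite tnth0.
by exists (lift ord0 j) => //; rewrite tnthS.
Qed.

Lemma measurable_redundant N (i : 'I_N) :
  measurable [set u : N.-tuple (plane R) | redundant u i].
Proof.
case: N i => [[]//|N] i.
have m0 : measurable [set u : N.+1.-tuple (plane R) | redundant u ord0].
  rewrite (_ : [set u | _] =
    [set u : N.+1.-tuple (plane R) | hull [tuple of behead u] (tnth u ord0)]).
    by apply: measurable_hull_graph; [exact: measurable_tnth|exact: measurable_behead].
  have red u : redundant u ord0 <-> hull [tuple of behead u] (tnth u ord0).
    have := redundant_cons (thead u) [tuple of behead u].
    by rewrite -tuple_eta.
  by apply/seteqP; split=> u /red.
rewrite (_ : [set u | _] = permute_tuple (tperm ord0 i) @^-1`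
    [set u : N.+1.-tuple (plane R) | redundant u ord0]).
  exact: measurable_permute_preimage.
apply/seteqP; split=> u /=.
  by move=> H; apply/redundant_permute; rewrite tpermL.
by move/redundant_permute; rewrite tpermL.
Qed.

End vertices.

(** * Adding one point *)

(** If passing from F to F' multiplies by at most b / a, and from G to G' by at
    least b / a, then the share of F decreases; an empty total has share 0. *)
Lemma ratio_le (R : realFieldType) (a b F G F' G' : R) :
  0 < a -> 0 <= F -> 0 <= G -> 0 <= F' -> 0 <= G' ->
  a * F' <= b * F -> b * G <= a * G' -> F' / (F' + G') <= F / (F + G).
Proof.
move=> a0 F0 G0 F0' G0' aF bG.
have [e|FG] := eqVneq (F + G) 0.
  have F00 : F = 0 by lra.
  have -> : F' = 0 by nra.
  by rewrite F00 !mul0r.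
have [e|FG'] := eqVneq (F' + G') 0.
  have -> : F' = 0 by lra.
  by rewrite mul0r divr_ge0// addr_ge0.
have s : 0 < F + G by rewrite lt_neqAle eq_sym FG addr_ge0.
have s' : 0 < F' + G' by rewrite lt_neqAle eq_sym FG' addr_ge0.
rewrite ler_pdivrMr// mulrAC ler_pdivlMr//.
suff : F' * G <= F * G' by nra.
have h1 : a * F' * G <= b * F * G by rewrite ler_wpM2r.
have h2 : b * G * F <= a * G' * F by rewrite ler_wpM2r.
rewrite -(ler_pM2l a0); lra.
Qed.

Lemma measure0_exists d (T : measurableType d) (R : realType)
    (mu : {measure set T -> \bar R}) (I : countType) (F : I -> set T) :
  (forall i, measurable (F i)) -> (forall i, mu (F i) = 0%E) ->
  mu [set x | exists i, F i x] = 0%E.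
Proof.
move=> mF F0; pose G k := if unpickle k is Some i then F i else set0.
have E : [set x | exists i, F i x] = \bigcup_k G k.
  apply/seteqP; split=> [x [i Fx]|x [k _]].
    by exists (pickle i) => //; rewrite /G pickleK.
  by rewrite /G; case: (unpickle k) => // i; exists i.
have mG k : measurable (G k) by rewrite /G; case: (unpickle k).
rewrite E; apply: measure_negligible; first exact: bigcup_measurable.
apply: negligible_bigcup => k; apply/negligibleP => //.
by rewrite /G; case: (unpickle k) => [i|]; [exact: F0|exact: measure0].
Qed.

Section one_step.
Variables (R : realType) (P : probability (plane R) R).
Hypothesis P_atomless : forall x, P [set x] = 0%E.
Implicit Types (n N : nat).

Lemma iid_law_eq_points N (i j : 'I_N) : i != j ->
  iid_law P N [set u | tnth u i = tnth u j] = 0%E.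
Proof.
case: N i j => [[]//|N] i j ij.
have mE (k l : 'I_N.+1) :
    measurable [set u : N.+1.-tuple (plane R) | tnth u k = tnth u l].
  by apply: measurable_plane_eq; exact: measurable_tnth.
(* exchange the i-th point with the first one, which is integrated out first *)
pose j' := tperm ord0 i j.
have -> : [set u | tnth u i = tnth u j] = permute_tuple (tperm ord0 i) @^-1`
    [set u : N.+1.-tuple (plane R) | tnth u ord0 = tnth u j'].
  by apply/seteqP; split=> u /=; rewrite !tnth_mktuple tpermL /j' tpermK.
rewrite iid_law_exchangeable// iid_law_cons// integral0_eq// => v _.
have [k jk|e] := unliftP ord0 j'; last first.
  by move: ij; rewrite -(inj_eq (@perm_inj _ (tperm ord0 i))) tpermR -/j' e eqxx.
rewrite (_ : [set x | _] = [set tnth v k]) ?P_atomless//.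
by apply/seteqP; split=> x /=; rewrite jk tnth0 tnthS.
Qed.

Definition distinct N : set (N.-tuple (plane R)) := [set u | injective (tnth u)].

Lemma distinctCE N : ~` (@distinct N) = [set u | exists p : 'I_N * 'I_N,
  p.1 != p.2 /\ tnth u p.1 = tnth u p.2].
Proof.
apply/seteqP; split=> u /=.
  move=> nI; apply: contrapT => H; apply: nI => i j e.
  by apply/eqP/negPn/negP => ij; apply: H; exists (i, j).
by move=> [[i j] /= [ij e]] /(_ _ _ e) ij'; rewrite ij' eqxx in ij.
Qed.

Lemma measurable_eq_pair N (p : 'I_N * 'I_N) :
  measurable [set u : N.-tuple (plane R) | p.1 != p.2 /\ tnth u p.1 = tnth u p.2].
Proof.
case: (p.1 != p.2).
  rewrite [X in measurable X](_ : _ =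
     [set u : N.-tuple (plane R) | tnth u p.1 = tnth u p.2]).
    by apply: measurable_plane_eq; exact: measurable_tnth.
  by apply/seteqP; split=> u //= [].
by rewrite [X in measurable X](_ : _ = set0)//; apply/seteqP; split=> u // [].
Qed.

Lemma measurable_distinct N : measurable (@distinct N).
Proof.
rewrite -[X in measurable X]setCK distinctCE; apply: measurableC.
by apply: measurable_exists_countable => p; exact: measurable_eq_pair.
Qed.

Lemma iid_law_distinct N (A : set (N.-tuple (plane R))) : measurable A ->
  iid_law P N A = iid_law P N (A `&` @distinct N).
Proof.
move=> mA; rewrite (measureDI _ mA (@measurable_distinct N)).
rewrite [X in (X + _)%E](_ : _ = 0%E) ?add0e//.
have D0 : iid_law P N (~` @distinct N) = 0%E.
  rewrite distinctCE; apply: measure0_exists; first exact: measurable_eq_pair.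
  move=> p; have [e|pp] := eqVneq p.1 p.2; last first.
    apply: eq_trans (iid_law_eq_points pp); congr (iid_law P N _).
    by apply/seteqP; split=> u //= [].
  apply: eq_trans (measure0 (iid_law P N)); congr (iid_law P N _).
  by apply/seteqP; split=> u // [].
apply/eqP; rewrite eq_le measure_ge0 andbT -D0; apply: le_measure.
- by rewrite inE; apply: measurableD => //; exact: measurable_distinct.
- by rewrite inE; apply: measurableC; exact: measurable_distinct.
- by move=> u [].
Qed.

Section hull_event.
Variable Phi : set (set (plane R)).

Definition hull_event N : set (N.-tuple (plane R)) := [set u | Phi (hull u)].

Hypothesis mPhi : forall N, measurable (@hull_event N).

Let Red N (i : 'I_N) := [set u : N.-tuple (plane R) | redundant u i].

Let mRed N (i : 'I_N) : measurable (@hull_event N `&` Red i).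
Proof. by apply: measurableI => //; exact: measurable_redundant. Qed.

(** By exchangeability the redundant point may be taken to be the first one,
    which then falls into the hull of the others without modifying it. *)
Lemma iid_law_redundant N (i : 'I_N.+1) :
  iid_law P N.+1 (@hull_event N.+1 `&` Red i) =
  (\int[iid_law P N]_(v in @hull_event N) P (hull v))%E.
Proof.
have -> : @hull_event N.+1 `&` Red i =
    permute_tuple (tperm ord0 i) @^-1` (@hull_event N.+1 `&` Red ord0).
  apply/seteqP; split=> u [/= hu ru]; split.
  - by rewrite /hull_event /= hull_permute.
  - by apply/redundant_permute; rewrite tpermL.
  - by rewrite /hull_event /= hull_permute in hu.
  - by move/redundant_permute: ru; rewrite tpermL.
rewrite iid_law_exchangeable// iid_law_cons// [RHS]integral_mkcond.
apply: eq_integral => v _; rewrite patchE.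
have [/set_mem hv|/negP nv] := boolP (v \in @hull_event N).
  congr (P _); apply/seteqP; split=> x /=; first by move=> [_ /redundant_cons].
  move=> hx; split; last by apply/redundant_cons.
  by rewrite /hull_event /= hull_cons.
rewrite (_ : [set x | _] = set0) ?measure0//.
apply/seteqP; split=> x // [/= hu /redundant_cons hx]; apply: nv.
by apply/mem_set; rewrite /hull_event /= in hu; rewrite hull_cons in hu.
Qed.

(** Almost surely the points are distinct, and then all points but the n
    vertices of the hull are redundant. *)
Lemma sum_iid_law_redundant n N : (forall C, Phi C -> (vertices C #= `I_n)%card) ->
  (\sum_(i < N) iid_law P N (@hull_event N `&` Red i) =
   (N - n)%:R%:E * iid_law P N (@hull_event N))%E.
Proof.
move=> PhiV; pose D := @distinct N; pose S := @hull_event N.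
have mD : measurable D := @measurable_distinct N.
have mSD : measurable (S `&` D) by exact: measurableI.
have mSRD i : measurable (S `&` Red i `&` D) by exact: measurableI.
rewrite (iid_law_distinct (@mPhi N)).
under eq_bigr => i _.
  rewrite iid_law_distinct// -[X in iid_law P N X]setIT -integral_indic//; over.
rewrite -ge0_integral_sum//; last first.
  by move=> i; apply/measurable_EFinP; exact: measurable_indic.
transitivity (\int[iid_law P N]_u ((N - n)%:R%:E * (\1_(S `&` D) u)%:E))%E; last first.
  rewrite ge0_integralZl//.
  - by rewrite integral_indic// setIT.
  - by apply/measurable_EFinP; exact: measurable_indic.
apply: eq_integral => u _; rewrite sumEFin -EFinM; congr EFin.
rewrite [in RHS]indicE; have [/set_mem[Su Du]|nu] := boolP (u \in S `&` D); last first.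
  rewrite mulr0 big1// => i _; rewrite indicE.
  case: (boolP (u \in _)) => // /set_mem[[Su _] Du].
  by move/negP: nu; case; apply/mem_set.
rewrite mulr1 -(card_redundant Du (PhiV _ Su)) -sum1_card natr_sum [RHS]big_mkcond /=.
apply: eq_bigr => i _; rewrite indicE inE.
case: asboolP => ri; first by rewrite mem_set.
by rewrite memNset// => -[[_]].
Qed.

Lemma iid_law_hull_event_step n N : (forall C, Phi C -> (vertices C #= `I_n)%card) ->
  ((N.+1 - n)%:R%:E * iid_law P N.+1 (@hull_event N.+1) =
   N.+1%:R%:E * \int[iid_law P N]_(v in @hull_event N) P (hull v))%E.
Proof.
move=> PhiV; rewrite -sum_iid_law_redundant//.
under eq_bigr do rewrite iid_law_redundant.
rewrite mule_natl; elim: N.+1 => [|k IH]; first by rewrite big_ord0.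
by rewrite big_ord_recl IH muleS.
Qed.

End hull_event.

Lemma measurable_prob_hull N :
  measurable_fun setT (fun u : N.-tuple (plane R) => P (hull u)).
Proof.
have mG : measurable [set z : N.-tuple (plane R) * plane R | hull z.1 z.2].
  by apply: measurable_hull_graph.
have := measurable_fun_xsection P mG; congr (measurable_fun _ _).
by apply/funext => u /=; congr (P _); apply/seteqP; split=> x; rewrite /xsection /= inE.
Qed.

Section thresholds.
Variables (n : nat) (c : R).
Hypothesis c0 : 0 <= c.

Definition small_hull : set (set (plane R)) :=
  [set C | (vertices C #= `I_n)%card /\ (P C <= c%:E)%E].
Definition large_hull : set (set (plane R)) :=
  [set C | (vertices C #= `I_n)%card /\ (c%:E < P C)%E].

Lemma measurable_small N : measurable (@hull_event small_hull N).
Proof.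
rewrite (_ : @hull_event _ N = @n_vertices R n N `&` [set u | P (hull u) <= c%:E]%E)//.
apply: measurableI; first exact: measurable_n_vertices.
rewrite -[X in measurable X]setTI.
by apply: emeasurable_fun_infty_c => //; exact: measurable_prob_hull.
Qed.

Lemma measurable_large N : measurable (@hull_event large_hull N).
Proof.
rewrite (_ : @hull_event _ N = @n_vertices R n N `&` [set u | c%:E < P (hull u)]%E)//.
apply: measurableI; first exact: measurable_n_vertices.
rewrite -[X in measurable X]setTI.
by apply: emeasurable_fun_o_infty => //; exact: measurable_prob_hull.
Qed.

Definition p_small N : R := fine (iid_law P N (@hull_event small_hull N)).
Definition p_large N : R := fine (iid_law P N (@hull_event large_hull N)).

Let iid_fine N (A : set (N.-tuple (plane R))) : measurable A ->
  iid_law P N A = (fine (iid_law P N A))%:E.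
Proof. by move=> mA; rewrite fineK//; exact: fin_num_measure. Qed.

Lemma p_small_step N :
  (N.+1 - n)%:R * p_small N.+1 <= N.+1%:R * c * p_small N.
Proof.
rewrite -lee_fin !EFinM -!iid_fine; [|exact: measurable_small..].
rewrite iid_law_hull_event_step; [|exact: measurable_small|by move=> C []].
rewrite -muleA lee_pmul2l// ?lte_fin ?ltr0n//.
have mS := @measurable_small N.
rewrite -integral_cst//; apply: ge0_le_integral => //.
- by apply: measurable_funTS; exact: measurable_prob_hull.
- by move=> v [].
Qed.

Lemma p_large_step N :
  N.+1%:R * c * p_large N <= (N.+1 - n)%:R * p_large N.+1.
Proof.
rewrite -lee_fin !EFinM -!iid_fine; [|exact: measurable_large..].
rewrite iid_law_hull_event_step; [|exact: measurable_large|by move=> C []].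
rewrite -muleA lee_pmul2l// ?lte_fin ?ltr0n//.
have mS := @measurable_large N.
rewrite -integral_cst//; apply: ge0_le_integral => //.
- by apply: measurable_funTS; exact: measurable_prob_hull.
- by move=> v [_ /ltW].
Qed.

Lemma iid_law_n_vertices N :
  fine (iid_law P N (@n_vertices R n N)) = p_small N + p_large N.
Proof.
have [mS mL] := (@measurable_small N, @measurable_large N).
rewrite -fineD ?fin_num_measure// -measureU//.
  congr (fine (iid_law P N _)); apply/seteqP; split=> u; last by move=> [[]|[]].
  by move=> vu; have [?|?] := leP (P (hull u)) c%:E; [left|right].
by apply/seteqP; split=> u // [[_ h] [_]]; rewrite ltNge h.
Qed.

(** Conditionally on having n vertices, more points make the hull larger: the
    comparison of the two one-step bounds. *)
Lemma small_hull_nonincreasing m m' : (m <= m')%N ->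
  p_small (n + m') / (p_small (n + m') + p_large (n + m')) <=
  p_small (n + m) / (p_small (n + m) + p_large (n + m)).
Proof.
elim: m' => [|m' IH]; first by rewrite leqn0 => /eqP ->.
rewrite leq_eqVlt => /predU1P[->//|]; rewrite ltnS => /IH; apply: le_trans.
rewrite addnS.
apply: (@ratio_le _ (((n + m').+1 - n)%:R) ((n + m').+1%:R * c));
  rewrite /p_small /p_large ?fine_ge0//.
- by rewrite ltr0n subn_gt0 ltnS leq_addr.
- exact: p_small_step.
- exact: p_large_step.
Qed.

End thresholds.

End one_step.

(** * Hausdorff distance between a convex body and a set inside it *)

Section hausdorff.
Variables (R : realType) (T : pseudoMetricType R).
Implicit Types (A K : set T) (e : R).

Lemma hausdorff_dist_gt A K e : 0 < e -> A `<=` K ->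
  (e%:E < hausdorff_dist A K)%E ->
  exists2 x, K x & forall y, A y -> ~ ball x e y.
Proof.
move=> e0 AK; rewrite /hausdorff_dist lt_max => /orP[] /ereal_sup_gt[_ [x Ax <-]].
  rewrite ltNge => /negP; case; apply: ereal_inf_le; exists (edist (x, x)).
    by exists x => //; exact: AK.
  by apply: edist_fin => //; exact: ballxx.
rewrite ltNge => /negP H; exists x => // y Ay xy; apply: H.
apply: ereal_inf_le; exists (edist (x, y)); first by exists y.
exact: edist_fin.
Qed.

Lemma hausdorff_dist_le A K e e' x : e < e' -> (hausdorff_dist A K <= e%:E)%E ->
  K x -> exists2 y, A y & ball x e' y.
Proof.
move=> ee'; rewrite /hausdorff_dist ge_max => /andP[_ H] Kx.
have : (edist_inf A x < e'%:E)%E.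
  apply: (@le_lt_trans _ _ e%:E); last by rewrite lte_fin.
  by apply: le_trans H; apply: ereal_sup_ubound; exists x.
by move=> /ereal_inf_lt[_ [y Ay <-]] /edist_lt_ball; exists y.
Qed.

End hausdorff.

(** * The conditional law *)

Section conditional.
Variables (R : realType) (K : set (plane R)).
Hypotheses (cK : compact K) (vK : convex_set K) (aK : area K = 1%E).
Implicit Types (n m N : nat).

Let U : probability (plane R) R := uniform_law cK aK.
Let mK : measurable K := compact_measurable_plane cK.

Lemma uniform_point x : U [set x] = 0%E.
Proof.
have m1 : measurable [set x].
  rewrite (_ : [set x] = [set z | z = x])//.
  exact: (@measurable_plane_eq R _ _ id (fun=> x)).
apply/eqP; rewrite eq_le measure_ge0 andbT.
have l0 : ((1, 0) : plane R) != 0 by apply/eqP => -[] /eqP; rewrite oner_eq0.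
rewrite -(area_line (lin (1, 0) x) l0) /U /= /uniform_law /mrestr.
apply: le_measure; rewrite ?inE.
- exact: measurableI.
- rewrite (_ : [set z | _] = lin (1, 0) @^-1` [set lin (1, 0) x])//.
  by rewrite -[X in measurable X]setTI; apply: measurable_lin.
- by move=> z [-> _].
Qed.

Definition in_body N : set (N.-tuple (plane R)) := [set u | forall i, K (tnth u i)].

Lemma measurable_in_body N : measurable (@in_body N).
Proof. exact: (@measurable_box _ _ N (fun=> K)). Qed.

Lemma iid_law_outside N : iid_law U N (~` @in_body N) = 0%E.
Proof.
rewrite probability_setC; last exact: measurable_in_body.
rewrite (_ : iid_law U N (@in_body N) = 1%E) ?subee//.
transitivity (iid_law U N (@box _ _ N (fun=> K))); first by [].
rewrite iid_law_box// big1// => i _.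
by rewrite /U /= /uniform_law /mrestr setIid aK.
Qed.

Lemma hull_in_body N (u : N.-tuple (plane R)) : in_body u -> hull u `<=` K.
Proof. by move=> Ku; apply: conv_hull_min => // _ [i _ <-]. Qed.

Let fin N (A : set (N.-tuple (plane R))) : iid_law U N A \is a fin_num.
Proof.
rewrite ge0_fin_numE ?measure_ge0//.
apply: (@le_lt_trans _ _ (iid_law U N setT)); first exact: le_iid_law.
exact: (le_lt_trans (probability_le1 (iid_law U N) measurableT) (ltry 1)).
Qed.

Lemma le_Q_measurable n m (A B : set ((n + m).-tuple (plane R))) :
  measurable (A `&` @n_vertices R n (n + m)) -> A `&` @in_body (n + m) `<=` B ->
  Q cK aK A <= Q cK aK B.
Proof.
move=> mA AB; rewrite /Q; apply: ler_wpM2r; first by rewrite invr_ge0 fine_ge0.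
apply: fine_le; [exact: fin|exact: fin|].
rewrite (measureDI _ mA (@measurable_in_body _)) [X in (X + _)%E](_ : _ = 0%E).
  by rewrite add0e; apply: le_iid_law => u [[Au vu] Ku]; split => //; exact: AB.
apply/eqP; rewrite eq_le measure_ge0 andbT -(iid_law_outside (n + m)).
by apply: le_iid_law => u [].
Qed.

Lemma le_measurable_Q n m (A B : set ((n + m).-tuple (plane R))) :
  measurable (B `&` @n_vertices R n (n + m)) -> A `&` @in_body (n + m) `<=` B ->
  Q cK aK A <= Q cK aK B.
Proof.
move=> mB AB; rewrite /Q; apply: ler_wpM2r; first by rewrite invr_ge0 fine_ge0.
apply: fine_le; [exact: fin|exact: fin|].
apply: (@le_trans _ _ (iid_law U (n + m)
    ((B `&` @n_vertices R n (n + m)) `|` ~` @in_body (n + m)))).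
  apply: le_iid_law => u [Au vu]; have [Ku|] := pselect (in_body u); last by right.
  by left; split => //; exact: AB.
apply: le_trans (measureU2 _ _ _) _ => //.
  by apply: measurableC; exact: measurable_in_body.
by rewrite [X in (_ + X)%E]iid_law_outside adde0.
Qed.

Definition small_area (c : R) N : set (N.-tuple (plane R)) :=
  [set u | (U (hull u) <= c%:E)%E].

Lemma small_areaE n (c : R) N :
  @small_area c N `&` @n_vertices R n N = @hull_event R (small_hull U n c) N.
Proof. by apply/seteqP; split=> u []. Qed.

Lemma Q_small_area n m (c : R) : Q cK aK (@small_area c (n + m)) =
  p_small U n c (n + m) / (p_small U n c (n + m) + p_large U n c (n + m)).
Proof. by rewrite /Q small_areaE (iid_law_n_vertices _ n c). Qed.

(** Far from K implies a small area, whose conditional probability is larger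
    with fewer points, and a small area implies not being close to K. *)
Lemma le_Q_hausdorff_dist (e : R) : 0 < e -> exists2 e' : R, 0 < e' &
  forall n m m', (m <= m')%N ->
    @Q R K cK aK n m' [set u | (e%:E < hausdorff_dist (hull u) K)%E] <=
    @Q R K cK aK n m [set u | (e'%:E < hausdorff_dist (hull u) K)%E].
Proof.
move=> e0; have [c [/andP[c0 c1] far]] := far_hull_deficit cK vK aK e0.
have [e' e'0 near] := near_hull_area cK vK aK c1.
exists (e' / 2); first by rewrite divr_gt0.
move=> n m m' mm'.
have mS N : measurable (@small_area c N `&` @n_vertices R n N).
  by rewrite small_areaE; exact: measurable_small.
apply: (@le_trans _ _ (Q cK aK (@small_area c (n + m')))).
  apply: le_measurable_Q => // u [ue Ku]; apply: far; first exact: measurable_hull.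
  exact: hausdorff_dist_gt e0 (hull_in_body Ku) ue.
apply: (@le_trans _ _ (Q cK aK (@small_area c (n + m)))).
  rewrite !Q_small_area; apply: small_hull_nonincreasing => //.
  exact: uniform_point.
apply: le_Q_measurable => // u [uc Ku] /=; rewrite ltNge; apply/negP => ue.
have : (c%:E < U (hull u))%E.
  apply: near => x Kx; apply: (hausdorff_dist_le _ ue Kx).
  by rewrite ltr_pdivrMr// ltr_pMr// ltr1n.
by rewrite ltNge uc.
Qed.

Lemma Q_ge0 n m (A : set ((n + m).-tuple (plane R))) : 0 <= Q cK aK A.
Proof. by rewrite /Q divr_ge0// fine_ge0. Qed.

End conditional.

Theorem theorem1p19 (R : realType) (K : set (plane R))
  (cK : compact K) (vK : convex_set K) (aK : area K = 1%E)
  (lambda : R) (lambda_ge0 : 0 <= lambda)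
  (Klambda : hull_cvg_in_probability cK aK
               (fun n => Num.truncn (n%:R * lambda)))
  (lambda' : R) (lambda_le : lambda <= lambda') :
  hull_cvg_in_probability cK aK (fun n => Num.truncn (n%:R * lambda')).
Proof.
move=> e e0; have [e' e'0 He] := le_Q_hausdorff_dist cK vK aK e0.
apply: (squeeze_cvgr _ (cvg_cst 0) (Klambda e' e'0)).
near=> n; rewrite Q_ge0 He//.
by apply: le_truncn; rewrite ler_wpM2l.
Unshelve. all: by end_near. Qed.
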